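(* For every real $x$ and every integer $n\ge 0$, $$\sum_{l=0}^{n}d_{l,\lambda}(x){n \brace l}_{Y,\lambda}= \sum_{j=0}^{n}\sum_{m=0}^{j}\binom{n}{j}{j \brace m}_{Y,\lambda}F_{n-j,\lambda}^{Y}(1)\,(x-1)_{m,\lambda}.$$
   Context: Let $\lambda$ be a nonzero real number. Set $(x)_{0,\lambda}=1$ and $(x)_{k,\lambda}=x(x-\lambda)\cdots(x-(k-1)\lambda)$ for $k\ge 1$. The degenerate exponential is $e_{\lambda}^{x}(t)=\sum_{k\ge 0}(x)_{k,\lambda}\frac{t^{k}}{k!}$ (so $e_\lambda^x(t)=(1+\lambda t)^{x/\lambda}$ for $t$ near $0$). All generating functions below are power series in $t$ near $0$. $Y$ is a real random variable whose moment generating function $E[e^{tY}]=\sum_{n\ge 0}E[Y^n]\frac{t^n}{n!}$ exists for $|t|<r$, for some $r>0$. $E$ denotes expectation. $(Y_j)_{j\ge 1}$ is a sequence of mutually independent copies of $Y$, $S_0=0$ and $S_k=Y_1+\cdots+Y_k$ for $k\ge 1$. The degenerate derangement polynomials $d_{n,\lambda}(x)$ are defined by $\frac{e_{\lambda}^{x-1}(t)}{1-t}=\sum_{n\ge 0}d_{n,\lambda}(x)\frac{t^{n}}{n!}$. The probabilistic degenerate Stirling numbers of the second kind associated with $Y$ are $${n \brace k}_{Y,\lambda}=\frac{1}{k!}\sum_{j=0}^{k}\binom{k}{j}(-1)^{k-j}E\big[(S_{j})_{n,\lambda}\big]\quad (n\ge k\ge 0).$$ The probabilistic degenerate Fubini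 polynomials associated with $Y$, $F_{n,\lambda}^{Y}(x)$, are defined by $$\frac{1}{1-x(E[e_{\lambda}^{Y}(t)]-1)}=\sum_{n=0}^{\infty}F_{n,\lambda}^{Y}(x)\frac{t^{n}}{n!}.$$ *)

(* Defs.v *)
From mathcomp Require Import all_boot all_order all_algebra finmap.
From mathcomp Require Import all_classical all_reals all_analysis.
Import Order.TTheory GRing.Theory Num.Theory.
Import numFieldNormedType.Exports.

Set Implicit Arguments.
Unset Strict Implicit.
Unset Printing Implicit Defensive.

Local Open Scope classical_set_scope.
Local Open Scope ring_scope.

Section GeneratingFunctions.
Context {R : realType}.

Definition dfact (lambda x : R) (k : nat) : R :=
  \prod_(i < k) (x - i%:R * lambda).

(* The series converges when |lambda * t| < 1. *)
Definition dexp (lambda x t : R) : R :=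
  limn (pseries (fun k => dfact lambda x k / k`!%:R) t).

Definition is_egf (a : nat -> R) (f : R -> R) : Prop :=
  \forall t \near (0 : R),
    pseries (fun n => a n / n`!%:R) t @ \oo --> f t.

(* The coefficient sequence defined by the generating function f: the
   sequence a with f t = \sum_n a n * t ^+ n / n`! for t near 0.  Such a
   sequence is unique when it exists; the default 0 is taken otherwise. *)
Definition egf_coef (f : R -> R) : nat -> R :=
  xget (fun=> 0) [set a | is_egf a f].

Definition dderangement (lambda : R) (n : nat) (x : R) : R :=
  egf_coef (fun t => dexp lambda (x - 1) t / (1 - t)) n.

End GeneratingFunctions.

Section Probabilistic.
Context {d : measure_display} {T : measurableType d} {R : realType}.
Variable P : probability T R.

Definition mutually_independent (X : nat -> {RV P >-> R}) : Prop :=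
  forall (J : {fset nat}) (B : nat -> set R), (forall i, measurable (B i)) ->
    P (\bigcap_(i in [set` J]) (X i @^-1` B i)) =
    (\prod_(i <- J) P (X i @^-1` B i))%E.

Definition identically_distributed (X Y : {RV P >-> R}) : Prop :=
  forall B : set R, measurable B -> distribution P X B = distribution P Y B.

(* Indices are shifted: Ys i stands for Y_{i+1}. *)
Definition iid_copies (Y : {RV P >-> R}) (Ys : nat -> {RV P >-> R}) : Prop :=
  mutually_independent Ys /\ forall i, identically_distributed (Ys i) Y.

Definition mgf_exists (Y : {RV P >-> R}) : Prop :=
  exists2 r : R, 0 < r & forall t : R, `|t| < r -> ('M_P Y t < +oo)%E.

Definition partial_sum (Ys : nat -> {RV P >-> R}) (k : nat) (w : T) : R :=
  \sum_(i < k) Ys i w.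

(* Stirling numbers {n brace k}_{Y,lambda}, with Ys a sequence of
   independent copies of Y. *)
Definition pdstirling2 (Ys : nat -> {RV P >-> R}) (lambda : R) (n k : nat) : R :=
  (k`!%:R)^-1 * \sum_(j < k.+1) 'C(k, j)%:R * (-1) ^+ (k - j) *
    fine 'E_P[fun w => dfact lambda (partial_sum Ys j w) n].

Definition pdfubini (Y : {RV P >-> R}) (lambda : R) (n : nat) (x : R) : R :=
  egf_coef (fun t =>
    1 / (1 - x * (fine 'E_P[fun w => dexp lambda (Y w) t] - 1))) n.

End Probabilistic.

(* Main.v *)
Require Import Defs.
From mathcomp Require Import all_boot all_order all_algebra finmap.
From mathcomp Require Import all_classical all_reals all_analysis measurable_realfun.
From mathcomp Require Import ring lra.
Import Order.TTheory GRing.Theory Num.Theory.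
Import numFieldNormedType.Exports.

Set Implicit Arguments.
Unset Strict Implicit.
Unset Printing Implicit Defensive.

Local Open Scope classical_set_scope.
Local Open Scope ring_scope.

(** Write c_n(y) = (y)_{n,lambda} / n! for the degenerate binomial coefficient,
a_n = E[c_n(Y)], and let phi(t) = sum_n a_n t^n be the generating function
E[e_lambda^Y(t)], p = phi - 1.  The theorem is the coefficient of t^n in

   D(p(t)) = F(t) . e_lambda^{x-1}(p(t)),

where D(s) = e_lambda^{x-1}(s) / (1 - s) generates the degenerate derangement
polynomials and F = 1 / (1 - p) generates the Fubini polynomials at 1.  This
identity is the substitution s = p(t) in the definition of D.

Two facts give the left-hand side and the sum over m on the right-hand side a
meaning as coefficients.  The Vandermonde convolution for c_n ([dbinomD]) and
independence give that E[c_n(S_j)] is the coefficient of t^n in phi^j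
([dmoment_partial_sum]); the alternating binomial sum defining the Stirling
numbers then yields (n!/k!) [t^n] p^k ([pdstirling2E], [sum_binom_conv_pow]).

The generating functions are only given as functions near 0, so the
coefficient sequences have to be extracted analytically.  The expectation of
e_lambda^Y(t) is expanded by dominated convergence: the moment generating
function bounds E[e^{delta |Y|}] for a small delta, and [dbinom_bound]
dominates every c_k(Y) t^k by e^{delta |Y|} (1/2)^k for small t
([has_pseries_dmoment]).  Quotients of power series are power series
([has_pseries_div]), and coefficients are unique ([has_pseries_inj]).

The substitution itself is formal: from the coefficient recurrences saying
that denominator times quotient is numerator, the identity follows for the
polynomials truncated at degree n, modulo 'X^(n+1) ([coef_comp_quotient]).

Independence enters through E[prod_i f_i(Y_i)] = prod_i E[f_i(Y_i)]
([Rintegral_prod]), obtained from the product rule on events by replacing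
indicators with integrable functions one factor at a time. *)

(** * Convergent power series near 0 *)

Section PowerSeries.
Context {R : realType}.
Implicit Types (u v w : nat -> R) (f g : R -> R) (t M : R).

Definition has_pseries u f := \forall t \near (0 : R), pseries u t @ \oo --> f t.

Lemma pseries0 u t : pseries u t 0 = 0.
Proof. by rewrite /pseries /series /= big_geq. Qed.

Lemma pseriesS u t N : pseries u t N.+1 = pseries u t N + u N * t ^+ N.
Proof. by rewrite /pseries /series /= big_nat_recr. Qed.

Lemma near0_ball (Q : R -> Prop) :
  (\forall t \near (0 : R), Q t) <-> exists2 e, 0 < e & forall t, `|t| < e -> Q t.
Proof.
split.
  move=> /nbhs_ballP[e /= e0 eQ]; exists e => // t te; apply: eQ.
  by rewrite /ball/= sub0r normrN.
move=> [e e0 eQ]; apply/nbhs_ballP; exists e => //= t.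
by rewrite /ball/= sub0r normrN; exact: eQ.
Qed.

Lemma small_ball M : 1 <= M -> \forall t \near (0 : R), M * `|t| <= 1 / 2.
Proof.
move=> M1; have M0 : 0 < M by exact: lt_le_trans M1.
apply/near0_ball; exists (1 / 2 / M); first by rewrite divr_gt0.
by move=> t; rewrite ltr_pdivlMr // mulrC => /ltW.
Qed.

(** A single bound [M] with [M * M ^+ n] replaces a pair of constants, which
keeps products and quotients of series within one parameter. *)
Lemma has_pseries_coef_bound u f : has_pseries u f ->
  exists2 M, 1 <= M & forall n, `|u n| <= M * M ^+ n.
Proof.
move=> /near0_ball[e e0 ue].
pose t := e / 2; have t0 : 0 < t by rewrite divr_gt0.
have te : `|t| < e by rewrite gtr0_norm // /t; lra.
have := ue _ te => /cvgP /cvg_series_bounded[K [Kreal Kf]].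
have {Kf} Kf n : `|u n * t ^+ n| <= `|K| + 1.
  by apply: Kf => //; rewrite (le_lt_trans (ler_norm K))// ltrDl.
pose M := `|K| + 1 + t^-1.
have M1 : 1 <= M by rewrite /M -addrA addrC -addrA lerDl addr_ge0 // invr_ge0 ltW.
exists M => // n.
have tn : 0 < t ^+ n by rewrite exprn_gt0.
have := Kf n; rewrite normrM (gtr0_norm tn) -ler_pdivlMr // => /le_trans; apply.
rewrite ler_pM ?addr_ge0 // ?invr_ge0 ?(ltW tn) //.
  by rewrite /M lerDl invr_ge0 ltW.
rewrite -exprVn lerXn2r ?nnegrE ?invr_ge0 ?(ltW t0) //.
  by rewrite (le_trans _ M1).
by rewrite /M lerDr addr_ge0.
Qed.

Lemma is_cvg_pseries_geometric u C q t : 0 <= C -> 0 <= q ->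
  (forall n, `|u n| <= C * q ^+ n) -> q * `|t| <= 1 / 2 -> cvgn (pseries u t).
Proof.
move=> C0 q0 uC qt; apply: normed_cvg.
apply: (@series_le_cvg _ _ (geometric C (q * `|t|))) => [n|n|n|].
- exact: normr_ge0.
- by rewrite /geometric /= mulr_ge0 // exprn_ge0 // mulr_ge0.
- rewrite /geometric /= normrM normrX exprMn mulrA.
  by rewrite ler_wpM2r // exprn_ge0.
- apply: is_cvg_geometric_series; rewrite ger0_norm ?mulr_ge0 //.
  by apply: le_lt_trans qt _; lra.
Qed.

(** For [K] to infinity this bounds tails; for [N = 0] it bounds all partial
sums at once, which is the domination needed under an expectation. *)
Lemma pseries_block_bound u C q t N K : 0 <= C -> 0 <= q ->
  (forall n, `|u n| <= C * q ^+ n) -> q * `|t| <= 1 / 2 ->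
  `|pseries u t (K + N)%N - pseries u t N| <= 2 * C * (q * `|t|) ^+ N.
Proof.
move=> C0 q0 uC; set s := q * `|t| => st; have s0 : 0 <= s by rewrite mulr_ge0.
apply: (@le_trans _ _ (2 * C * (s ^+ N - s ^+ (K + N)))); last first.
  by rewrite ler_wpM2l ?mulr_ge0 // gerBl exprn_ge0.
elim: K => [|K IH]; first by rewrite add0n !subrr normr0 mulr0.
rewrite addSn pseriesS addrAC.
apply: (le_trans (ler_normD _ _)); apply: (le_trans (lerD IH (lexx _))).
have : `|u (K + N)%N * t ^+ (K + N)| <= C * s ^+ (K + N).
  by rewrite normrM normrX exprMn mulrA ler_wpM2r // exprn_ge0.
have sK : 0 <= s ^+ (K + N) by rewrite exprn_ge0.
have : C * s ^+ (K + N) * s <= C * s ^+ (K + N) * (1 / 2).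
  by rewrite ler_wpM2l // mulr_ge0.
rewrite exprS; lra.
Qed.

Lemma pseries_tail u C q t l N : 0 <= C -> 0 <= q ->
  (forall n, `|u n| <= C * q ^+ n) -> q * `|t| <= 1 / 2 ->
  pseries u t @ \oo --> l ->
  `|l - pseries u t N| <= 2 * C * (q * `|t|) ^+ N.
Proof.
move=> C0 q0 uC qt ul.
have cv : `|pseries u t (K + N)%N - pseries u t N| @[K --> \oo] -->
    `|l - pseries u t N|.
  by apply: cvg_norm; apply: cvgB; [rewrite (cvg_shiftn N (pseries u t)) | exact: cvg_cst].
by apply: cvgr_to_le cv _; apply: nearW => K; exact: pseries_block_bound.
Qed.

Lemma has_pseriesB u v f g : has_pseries u f -> has_pseries v g ->
  has_pseries (fun n => u n - v n) (fun t => f t - g t).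
Proof.
move=> uf vg; near=> t.
have -> : pseries (fun n => u n - v n) t = (fun N => pseries u t N - pseries v t N).
  apply/funext => N; rewrite /pseries /series /= -sumrB.
  by apply: eq_bigr => i _; rewrite mulrBl.
by apply: cvgB; near: t.
Unshelve. all: by end_near. Qed.

Lemma has_pseries_eq u f g :
  (\forall t \near (0 : R), f t = g t) -> has_pseries u f -> has_pseries u g.
Proof. by move=> fg uf; near=> t; rewrite -(near fg t) //; near: t. 
Unshelve. all: by end_near. Qed.

(** At the first index where the coefficients differ, that term is of order
[t ^+ m] while everything after it is of order [t ^+ m.+1]. *)
Lemma has_pseries_inj u v f : has_pseries u f -> has_pseries v f -> u = v.
Proof.
move=> uf vf; have := has_pseriesB uf vf; set w := fun n => _ => wf.
suff w0 m : w m = 0 by apply/funext => m; apply/eqP; rewrite -subr_eq0 -/(w m) w0.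
have [M M1 wM] := has_pseries_coef_bound wf.
have M0 : 0 <= M by rewrite (le_trans _ M1).
elim/ltn_ind: m => m IH.
have : \forall t \near (0 : R), M * `|t| <= 1 / 2 /\ pseries w t @ \oo --> f t - f t.
  by near=> t; split; near: t => //; exact: small_ball.
move=> /near0_ball[e e0 we].
have key t : 0 < t < e -> `|w m| <= 2 * M * M ^+ m.+1 * t.
  move=> /andP[t0 te]; have tn : `|t| = t by rewrite gtr0_norm.
  have [|Mt wt] := we t; first by rewrite tn.
  have := pseries_tail m.+1 M0 M0 wM Mt wt.
  rewrite /pseries /series /= subrr sub0r normrN big_nat_recr //= big_nat big1 ?add0r.
    rewrite normrM normrX tn exprMn (exprS t) !mulrA ler_pM2r ?exprn_gt0 //.
  by move=> i /= im; rewrite IH ?mul0r.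
apply/eqP; rewrite -normr_le0 leNgt; apply/negP => wpos.
have A0 : 0 <= 2 * M * M ^+ m.+1 by rewrite !mulr_ge0 ?exprn_ge0.
set A := 2 * M * _ in key A0.
(* Small enough that [A * t < `|w m|], contradicting [key]. *)
pose t := Num.min (e / 2) (`|w m| / (2 * (A + 1))).
have t0 : 0 < t by rewrite lt_min !divr_gt0 // mulr_gt0 // ltr_wpDl.
have te : t < e by rewrite gt_min; apply/orP; left; lra.
have := key t; rewrite t0 te => /(_ isT); apply/negP; rewrite -ltNge.
apply: (@le_lt_trans _ _ (A * (`|w m| / (2 * (A + 1))))).
  by rewrite ler_wpM2l // ge_min lexx orbT.
have A1 : 0 < 2 * (A + 1) by lra.
rewrite mulrA ltr_pdivrMr //; nra.
Unshelve. all: by end_near. Qed.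

Definition cauchyp u v n : R := \sum_(k < n.+1) u k * v (n - k)%N.

(** Summing the triangle [i + j < N] by rows: the inner sums are partial sums of
the second series, so each differs from its limit by a geometric tail. *)
Lemma pseries_cauchyp u v t N :
  pseries (cauchyp u v) t N = \sum_(i < N) u i * t ^+ i * pseries v t (N - i)%N.
Proof.
elim: N => [|N IH]; first by rewrite pseries0 big_ord0.
rewrite pseriesS {}IH [RHS]big_ord_recr /= subSnn.
rewrite /cauchyp mulr_suml big_ord_recr /= subnn addrA; congr (_ + _); last first.
  by rewrite pseriesS pseries0 add0r expr0 mulr1 mulrAC.
rewrite -big_split /=; apply: eq_bigr => i _.
have iN : (i <= N)%N by rewrite ltnW.
rewrite subSn // pseriesS mulrDr; congr (_ + _).
have -> : t ^+ N = t ^+ i * t ^+ (N - i) by rewrite -exprD subnKC.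
ring.
Qed.

Lemma has_pseriesM u v f g : has_pseries u f -> has_pseries v g ->
  has_pseries (cauchyp u v) (fun t => f t * g t).
Proof.
move=> uf vg.
have [M1 M11 uM1] := has_pseries_coef_bound uf.
have [M2 M21 vM2] := has_pseries_coef_bound vg.
pose M := M1 + M2.
have MM1 : M1 <= M by rewrite /M; lra.
have MM2 : M2 <= M by rewrite /M; lra.
have M10 : 0 <= M1 by lra.
have M20 : 0 <= M2 by lra.
have M0 : 0 <= M by lra.
have uM n : `|u n| <= M * M ^+ n.
  by rewrite (le_trans (uM1 n)) // -!exprS lerXn2r // nnegrE.
have vM n : `|v n| <= M * M ^+ n.
  by rewrite (le_trans (vM2 n)) // -!exprS lerXn2r // nnegrE.
have M4 : 1 <= 2 * M by lra.
near=> t.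
(* The ratio is at most 1/4, so that the number N of rows is absorbed by
   [N * (1 / 4) ^+ N <= (1 / 2) ^+ N]. *)
have Mt4 : 2 * M * `|t| <= 1 / 2 by near: t; exact: small_ball.
have ut : pseries u t @ \oo --> f t by near: t.
have vt : pseries v t @ \oo --> g t by near: t.
set s := M * `|t|.
have s4 : s <= 1 / 4 by rewrite /s; lra.
have s0 : 0 <= s by rewrite mulr_ge0.
have Mt : M * `|t| <= 1 / 2 by rewrite -/s; lra.
have bnd N : `|pseries u t N * g t - pseries (cauchyp u v) t N| <=
    geometric (2 * M ^+ 2) (1 / 2) N.
  rewrite pseries_cauchyp {1}/pseries /series /= big_mkord mulr_suml -sumrB.
  apply: (le_trans (ler_norm_sum _ _ _)).
  apply: (@le_trans _ _ (\sum_(i < N) 2 * M ^+ 2 * s ^+ N)).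
    apply: ler_sum => i _; rewrite -mulrBr normrM.
    have iN : (i <= N)%N by rewrite ltnW.
    apply: (@le_trans _ _ (M * s ^+ i * (2 * M * s ^+ (N - i)))).
      rewrite ler_pM //; first by rewrite normrM normrX exprMn mulrA ler_wpM2r // exprn_ge0.
      exact: pseries_tail.
    have -> : s ^+ N = s ^+ i * s ^+ (N - i) by rewrite -exprD subnKC.
    rewrite le_eqVlt; apply/orP; left; apply/eqP; ring.
  rewrite sumr_const card_ord /geometric /= -mulrnAr ler_wpM2l ?mulr_ge0 ?exprn_ge0 //.
  apply: (@le_trans _ _ ((1 / 4) ^+ N *+ N)).
    by rewrite lerMn2r lerXn2r ?nnegrE ?orbT //; lra.
  have -> : (1 / 4 : R) = 1 / 2 * (1 / 2) by lra.
  rewrite exprMn -mulrnAr ger_pMr ?exprn_gt0 //.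
  rewrite expr_div_n expr1n mul1r -mulr_natr mulrC ler_pdivrMr ?exprn_gt0 // mul1r.
  by rewrite -natrX ler_nat ltnW // ltn_expl.
have cvd : pseries u t N * g t - pseries (cauchyp u v) t N @[N --> \oo] --> (0 : R).
  apply/cvgr0Pnorm_le => e e0.
  have h : `|1 / 2 : R| < 1 by rewrite ger0_norm; lra.
  have /cvgr0Pnorm_le/(_ e e0) := @cvg_geometric _ (2 * M ^+ 2) (1 / 2) h.
  by apply: filterS => N /(le_trans (ler_norm _)); exact: le_trans (bnd N).
have -> : pseries (cauchyp u v) t =
    (fun N => pseries u t N * g t - (pseries u t N * g t - pseries (cauchyp u v) t N)).
  by apply/funext => N; rewrite subKr.
rewrite -[X in _ --> X]subr0; apply: cvgB => //.
by apply: cvgMl.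
Unshelve. all: by end_near. Qed.
End PowerSeries.

Section Division.
Context {R : realType}.
Implicit Types (u v w : nat -> R) (f g : R -> R).

(** The quotient [w] of the series [v] by the series [u] (with [u 0 = 1]) is given
by course-of-values recursion, so the recursion carries the list of the
coefficients found so far. *)
Fixpoint quot_coefs u v n : seq R :=
  if n is m.+1 then
    let s := quot_coefs u v m in
    rcons s (v m - \sum_(k < m) u (m - k)%N * s`_k)
  else [::].

Definition quot_coef u v n := (quot_coefs u v n.+1)`_n.

Lemma size_quot_coefs u v n : size (quot_coefs u v n) = n.
Proof. by elim: n => //= n IH; rewrite size_rcons IH. Qed.

Lemma nth_quot_coefs u v n k : (k < n)%N -> (quot_coefs u v n)`_k = quot_coef u v k.
Proof.
elim: n => // n IH; rewrite ltnS leq_eqVlt => /orP[/eqP-> //|kn].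
by rewrite /= nth_rcons size_quot_coefs kn IH.
Qed.

Lemma quot_coefE u v n :
  quot_coef u v n = v n - \sum_(k < n) u (n - k)%N * quot_coef u v k.
Proof.
rewrite /quot_coef /= nth_rcons size_quot_coefs ltnn eqxx.
by congr (_ - _); apply: eq_bigr => k _; rewrite nth_quot_coefs.
Qed.

Lemma cauchyp_quot u v : u 0%N = 1 -> cauchyp u (quot_coef u v) = v.
Proof.
move=> u0; apply/funext => n; rewrite /cauchyp (reindex_inj rev_ord_inj) /=.
rewrite big_ord_recr /= subSS subnn u0 mul1r subn0 (quot_coefE u v n).
rewrite addrC -addrA [X in _ + X](_ : _ = 0) ?addr0 //.
apply/eqP; rewrite addrC subr_eq0; apply/eqP.
by apply: eq_bigr => k _; rewrite subSS subKn // ltnW.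
Qed.

(** [L ^+ n.+1] is a supersolution of the recursion [quot_coefE] in which every
given coefficient is replaced by its bound.  From [n] to [n.+1] the left-hand
side is multiplied by [M] and gains [M ^+ 2 * L ^+ n.+1]. *)
Lemma quot_majorant (M L : R) n : 1 <= M -> M + M ^+ 2 <= L ->
  M ^+ n.+1 + \sum_(k < n) M ^+ (n - k).+1 * L ^+ k.+1 <= L ^+ n.+1.
Proof.
move=> M1 ML; have M20 : 0 <= M ^+ 2 by rewrite exprn_ge0 //; lra.
elim: n => [|n IH]; first by rewrite big_ord0 addr0 !expr1; lra.
rewrite big_ord_recr /= subSnn.
have -> : \sum_(i < n) M ^+ (n.+1 - i).+1 * L ^+ i.+1 =
    M * \sum_(k < n) M ^+ (n - k).+1 * L ^+ k.+1.
  by rewrite mulr_sumr; apply: eq_bigr => i _; rewrite subSn 1?ltnW // exprS mulrA.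
rewrite exprS addrA -mulrDr [leRHS]exprS.
have Ln : 0 <= L ^+ n.+1 by rewrite exprn_ge0 //; lra.
apply: (@le_trans _ _ ((M + M ^+ 2) * L ^+ n.+1)); last by rewrite ler_wpM2r.
by rewrite mulrDl lerD // ler_wpM2l //; lra.
Qed.

Lemma quot_coef_bound u v (M : R) : 1 <= M ->
  (forall n, `|u n| <= M * M ^+ n) -> (forall n, `|v n| <= M * M ^+ n) ->
  forall n, `|quot_coef u v n| <= (M + M ^+ 2) * (M + M ^+ 2) ^+ n.
Proof.
move=> M1 uM vM; elim/ltn_ind => n IH; rewrite -exprS.
apply: le_trans (quot_majorant n M1 (lexx _)); rewrite quot_coefE.
apply: (le_trans (ler_normB _ _)); apply: lerD; first by rewrite exprS.
apply: (le_trans (ler_norm_sum _ _ _)); apply: ler_sum => k _.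
by rewrite normrM ler_pM // exprS ?uM // IH.
Qed.

Lemma has_pseries_neq0 u f : has_pseries u f -> u 0%N = 1 ->
  \forall t \near (0 : R), f t != 0.
Proof.
move=> uf u0; have [M M1 uM] := has_pseries_coef_bound uf.
have M0 : 0 <= M by lra.
have M1' : 1 <= 4 * M * M by nra.
near=> t.
(* This makes the tail after the constant term 1 smaller than 1. *)
have Mt : 4 * M * M * `|t| <= 1 / 2 by near: t; exact: small_ball.
have t0 := normr_ge0 t.
have Mt' : M * `|t| <= 1 / 2 by nra.
have ut : pseries u t @ \oo --> f t by near: t.
have := pseries_tail 1 M0 M0 uM Mt' ut.
rewrite pseriesS pseries0 add0r u0 expr0 mulr1 expr1 => h.
apply/eqP => f0; move: h; rewrite f0 sub0r normrN normr1; nra.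
Unshelve. all: by end_near. Qed.

(** The candidate quotient series converges because its coefficients grow at
most geometrically; its sum times [f] is [g] by the Cauchy product. *)
Lemma has_pseries_div u v f g : has_pseries u f -> u 0%N = 1 -> has_pseries v g ->
  has_pseries (quot_coef u v) (fun t => g t / f t).
Proof.
move=> uf u0 vg; set w := quot_coef u v.
have [M1 M11 uM1] := has_pseries_coef_bound uf.
have [M2 M21 vM2] := has_pseries_coef_bound vg.
pose M := M1 + M2; have M1' : 1 <= M by rewrite /M; lra.
have uM n : `|u n| <= M * M ^+ n.
  by rewrite (le_trans (uM1 n)) // -!exprS lerXn2r ?nnegrE // /M; lra.
have vM n : `|v n| <= M * M ^+ n.
  by rewrite (le_trans (vM2 n)) // -!exprS lerXn2r ?nnegrE // /M; lra.
have wL := quot_coef_bound M1' uM vM.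
have L1 : 1 <= M + M ^+ 2 by rewrite ler_wpDr // exprn_ge0 //; lra.
have L0 : 0 <= M + M ^+ 2 by lra.
have wh : has_pseries w (fun t => limn (pseries w t)).
  near=> t; have Lt : (M + M ^+ 2) * `|t| <= 1 / 2 by near: t; exact: small_ball.
  exact: (is_cvg_pseries_geometric L0 L0 wL Lt).
have := has_pseriesM uf wh; rewrite cauchyp_quot // => vfh.
apply: has_pseries_eq wh; near=> t.
have f0 : f t != 0 by near: t; exact: has_pseries_neq0 uf u0.
have vt : pseries v t @ \oo --> g t by near: t.
have vt' : pseries v t @ \oo --> f t * limn (pseries w t) by near: t.
have -> : g t = f t * limn (pseries w t) by exact: cvg_unique vt vt'.
by rewrite mulrC mulKf.
Unshelve. all: by end_near. Qed.

(** Uniqueness of coefficients makes the choice in [egf_coef] harmless. *)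
Lemma egf_coefE (c : nat -> R) f : has_pseries c f ->
  forall n, egf_coef f n = n`!%:R * c n.
Proof.
move=> cf n; pose a k := k`!%:R * c k.
have fact0 k : k`!%:R != 0 :> R by rewrite pnatr_eq0 -lt0n fact_gt0.
have ac : (fun k => a k / k`!%:R) = c.
  by apply/funext => k; rewrite /a mulrAC mulfV // mul1r.
have fa : is_egf a f by rewrite /is_egf ac.
have := @xgetPex _ (fun=> 0) [set a | is_egf a f] (ex_intro _ a fa).
rewrite -/(egf_coef f) /= => fb.
have := has_pseries_inj fb cf => /(congr1 (fun h => h n)) /= <-.
by rewrite mulrCA mulfV // mulr1.
Qed.
End Division.

(** * Degenerate binomial coefficients *)

Section DegenerateBinomial.
Context {R : realType}.
Implicit Types (lambda x y z t : R).

Definition dbinom lambda x n : R := dfact lambda x n / n`!%:R.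

Lemma dbinom0 lambda x : dbinom lambda x 0 = 1.
Proof. by rewrite /dbinom /dfact big_ord0 fact0 divr1. Qed.

Lemma dbinomS lambda x n :
  n.+1%:R * dbinom lambda x n.+1 = (x - n%:R * lambda) * dbinom lambda x n.
Proof.
have n0 : n.+1%:R != 0 :> R by rewrite pnatr_eq0.
have f0 : n`!%:R != 0 :> R by rewrite pnatr_eq0 -lt0n fact_gt0.
rewrite /dbinom /dfact big_ord_recr /= factS natrM; field.
by rewrite f0 nat1r n0.
Qed.

Lemma dbinom_at0 lambda n : dbinom lambda 0 n = (n == 0%N)%:R.
Proof.
case: n => [|n]; first by rewrite dbinom0.
by rewrite /dbinom /dfact big_ord_recl /= mul0r subr0 mul0r mul0r.
Qed.

(** Vandermonde convolution.  Multiplying by [n.+1] and splitting this factor as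
[i + (n.+1 - i)] reduces it to the one-step recurrence [dbinomS] in each
argument, whose factors add up to [x + y - n lambda]. *)
Lemma dbinomD lambda x y n :
  dbinom lambda (x + y) n = cauchyp (dbinom lambda x) (dbinom lambda y) n.
Proof.
elim: n => [|n IH]; first by rewrite /cauchyp big_ord1 !dbinom0 mulr1.
have n0 : n.+1%:R != 0 :> R by rewrite pnatr_eq0.
apply: (mulfI n0); rewrite dbinomS IH /cauchyp !mulr_sumr.
have -> : \sum_(i < n.+2) n.+1%:R * (dbinom lambda x i * dbinom lambda y (n.+1 - i)) =
  \sum_(i < n.+2) (i%:R * dbinom lambda x i) * dbinom lambda y (n.+1 - i) +
  \sum_(i < n.+2) dbinom lambda x i * ((n.+1 - i)%:R * dbinom lambda y (n.+1 - i)).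
  rewrite -big_split /=; apply: eq_bigr => i _.
  rewrite natrB -1?ltnS //; ring.
rewrite [X in _ = X + _]big_ord_recl /= !mul0r add0r.
rewrite [X in _ = _ + X]big_ord_recr /= subnn mul0r mulr0 addr0.
rewrite -big_split /=; apply: eq_bigr => i _.
have iN : (i <= n)%N by rewrite -ltnS.
rewrite subSS dbinomS subSn // dbinomS natrB //; ring.
Qed.

(** Every factor of the product is at most [z = |y| + k |lambda|], and
[(delta z) ^+ k / k! <= expR (delta z)].  The free parameter [delta] is what lets
the bound stay below an existing exponential moment. *)
Lemma dbinom_bound lambda y delta k : 0 < delta ->
  `|dbinom lambda y k| <=
    expR (delta * `|y|) * (expR (delta * `|lambda|) / delta) ^+ k.
Proof.
move=> d0; set a : R := `|lambda|; pose z : R := `|y| + k%:R * a.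
have a0 : 0 <= a by rewrite normr_ge0.
have z0 : 0 <= z by rewrite addr_ge0 // mulr_ge0.
have dz0 : 0 <= delta * z by rewrite mulr_ge0 // ltW.
have fk : 0 < k`!%:R :> R by rewrite ltr0n fact_gt0.
have h1 : `|dfact lambda y k| <= z ^+ k.
  rewrite /dfact normr_prod -[k in z ^+ k]card_ord -prodr_const.
  apply: ler_prod => i _; rewrite normr_ge0 /=.
  apply: (le_trans (ler_normB _ _)); rewrite lerD2l normrM ger0_norm //.
  by rewrite ler_wpM2r // ler_nat ltnW.
have h2 : (delta * z) ^+ k / k`!%:R <= expR (delta * z).
  case: k @z z0 dz0 fk {h1} => [|k] z z0 dz0 fk.
    rewrite expr0 fact0 divr1; have := expR_ge1Dx (delta * z); lra.
  by have := expR_ge1Dxn k dz0; lra.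
rewrite /dbinom normrM normfV (gtr0_norm fk).
rewrite exprMn -expRM_natr exprVn mulrA -expRD ler_pdivlMr ?exprn_gt0 //.
have -> : delta * `|y| + delta * a * k%:R = delta * z by rewrite /z; ring.
apply: le_trans h2; rewrite exprMn mulrAC. apply: ler_wpM2r; first by rewrite invr_ge0 ltW.
by rewrite mulrC ler_wpM2l // exprn_ge0 // ltW.
Qed.

Lemma dexp_pseries lambda y t :
  dexp lambda y t = limn (pseries (dbinom lambda y) t).
Proof. by []. Qed.

Lemma cvg_pseries_dexp lambda y t delta : 0 < delta ->
  expR (delta * `|lambda|) / delta * `|t| <= 1 / 2 ->
  pseries (dbinom lambda y) t @ \oo --> dexp lambda y t.
Proof.
move=> d0 td; rewrite dexp_pseries.
apply: (@is_cvg_pseries_geometric _ _ (expR (delta * `|y|)) _ _ _ _ _ td).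
- exact: expR_ge0.
- by rewrite divr_ge0 ?expR_ge0 // ltW.
- by move=> n; exact: dbinom_bound.
Qed.

Lemma has_pseries_dexp lambda y :
  has_pseries (dbinom lambda y) (dexp lambda y).
Proof.
near=> t; apply: (cvg_pseries_dexp ltr01); near: t.
apply: small_ball; rewrite divr1 mul1r -expR0 ler_expR.
exact: normr_ge0.
Unshelve. all: by end_near. Qed.
End DegenerateBinomial.

(** * Expectation of products of independent variables *)

Section Independence.
Context {d : measure_display} {T : measurableType d} {R : realType}.
Variable P : probability T R.

Import HBNNSimple.

Lemma measurable_preimage_RV (V : {RV P >-> R}) B :
  measurable B -> measurable (V @^-1` B).
Proof.
by move=> mB; rewrite -[X in measurable X]setTI; exact: (measurable_funP V).
Qed.

Lemma integral_indic_comp (V : {RV P >-> R}) B : measurable B ->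
  (\int[P]_w (1 * \1_B (V w))%:E = P (V @^-1` B))%E.
Proof.
move=> mB; have := integral_indic P measurableT (measurable_preimage_RV V mB).
by rewrite setIT => <-; apply: eq_integral => w _; rewrite mul1r.
Qed.

Section OneFactor.
Variables (G : T -> R) (V : {RV P >-> R}) (c : R).
Hypothesis mG : measurable_fun setT G.
Hypothesis G0 : forall w, 0 <= G w.
Hypothesis GV : forall B, measurable B ->
  (\int[P]_w (G w * \1_B (V w))%:E = c%:E * P (V @^-1` B))%E.

Let mV (f : R -> R) : measurable_fun setT f -> measurable_fun setT (f \o V).
Proof. by move=> mf; apply: measurableT_comp. Qed.

Let integral_mul_nnsfun (H : T -> R) (h : {nnsfun R >-> R}) :
  measurable_fun setT H -> (forall w, 0 <= H w) ->
  (\int[P]_w (H w * h (V w))%:E =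
   \sum_(r <- fset_set (range h)) r%:E * \int[P]_w (H w * \1_(h @^-1` [set r]) (V w))%:E)%E.
Proof.
move=> mH H0; set s := fset_set _.
have mterm (r : R) : measurable_fun setT (fun w => H w * \1_(h @^-1` [set r]) (V w)).
  by apply: measurable_funM => //; apply: mV; exact: measurable_indic.
transitivity (\int[P]_w (\sum_(r <- s) r%:E * (H w * \1_(h @^-1` [set r]) (V w))%:E))%E.
  apply: eq_integral => w _; rewrite fimfunE fsbig_finite //= -/s mulr_sumr -sumEFin.
  by apply: eq_bigr => r _; rewrite -EFinM mulrCA.
rewrite ge0_integral_sum //; last 2 first.
- by move=> r; apply/measurable_EFinP; exact: measurable_funM.
- by move=> r w _; rewrite EFinM muleCA mule_ge0 ?nnfun_muleindic_ge0 ?lee_fin.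
rewrite [LHS]big_seq [RHS]big_seq; apply: eq_bigr => r rs.
rewrite ge0_integralZl //.
- by apply/measurable_EFinP.
- by move=> w _; rewrite lee_fin mulr_ge0.
- by move: rs; rewrite in_fset_set // inE => -[y _ <-]; rewrite lee_fin.
Qed.

(** The hypothesis is the conclusion for indicators; it extends to simple
functions by linearity and to nonnegative [f] by monotone convergence.  The
constant [c] is finite so that it commutes with that limit. *)
Lemma ge0_integral_factor (f : R -> R) :
  measurable_fun setT f -> (forall y, 0 <= f y) ->
  (\int[P]_w (G w * f (V w))%:E = c%:E * \int[P]_w (f (V w))%:E)%E.
Proof.
move=> mf f0.
have mf' : measurable_fun setT (EFin \o f) by apply/measurable_EFinP.
pose h := nnsfun_approx measurableT mf'.
have hf y : (h n y)%:E @[n --> \oo] --> (f y)%:E.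
  by apply: (cvg_nnsfun_approx measurableT mf') => // x _; rewrite lee_fin.
have nd y n m : (n <= m)%N -> h n y <= h m y.
  by move=> nm; exact/lefP/nd_nnsfun_approx.
have mh n : measurable_fun setT (h n : R -> R) by [].
have lhs : (\int[P]_w (G w * h n (V w))%:E)%E @[n --> \oo] -->
    (\int[P]_w (G w * f (V w))%:E)%E.
  have -> : (\int[P]_w (G w * f (V w))%:E)%E =
      (\int[P]_w limn (fun n => (G w * h n (V w))%:E))%E.
    apply: eq_integral => w _; apply/esym/cvg_lim => //.
    have Gfin : (G w)%:E \is a fin_num by [].
    exact: (cvgeZl Gfin (hf (V w))).
  apply: cvg_monotone_convergence => //.
  - by move=> n; apply/measurable_EFinP; apply: measurable_funM => //; exact: mV.
  - by move=> n w _; rewrite lee_fin mulr_ge0.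
  - by move=> w _ n m nm; rewrite lee_fin ler_wpM2l // nd.
have rhs : (c%:E * \int[P]_w (h n (V w))%:E)%E @[n --> \oo] -->
    (c%:E * \int[P]_w (f (V w))%:E)%E.
  apply: cvgeZl => //.
  have -> : (\int[P]_w (f (V w))%:E)%E = (\int[P]_w limn (fun n => (h n (V w))%:E))%E.
    by apply: eq_integral => w _; apply/esym/cvg_lim => //; exact: hf.
  apply: cvg_monotone_convergence => //.
  - by move=> n; apply/measurable_EFinP; exact: mV.
  - by move=> n w _; rewrite lee_fin.
  - by move=> w _ n m nm; rewrite lee_fin nd.
suff E : (fun n => \int[P]_w (G w * h n (V w))%:E)%E =
         (fun n => c%:E * \int[P]_w (h n (V w))%:E)%E.
  by rewrite E in lhs; exact: cvg_unique lhs rhs.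
apply/funext => n; rewrite integral_mul_nnsfun //.
have -> : (\int[P]_w (h n (V w))%:E = \int[P]_w (1 * h n (V w))%:E)%E.
  by apply: eq_integral => w _; rewrite mul1r.
rewrite integral_mul_nnsfun // fin_num_sume_distrr //; last first.
  move=> r1 r2 _ _; apply: fin_num_adde_defl; rewrite fin_numM //.
  by rewrite (integral_indic_comp V) // fin_num_measure //; exact: measurable_preimage_RV.
apply: eq_bigr => r _; rewrite GV // muleCA; congr (_ * (_ * _))%E.
by rewrite integral_indic_comp.
Qed.

End OneFactor.
End Independence.

Section IndependentProducts.
Context {d : measure_display} {T : measurableType d} {R : realType}.
Variables (P : probability T R) (Ys : nat -> {RV P >-> R}).
Hypothesis indep : mutually_independent Ys.
Implicit Types f : nat -> R -> R.

Definition integrand (V : {RV P >-> R}) (g : R -> R) :=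
  measurable_fun setT g /\ P.-integrable setT (EFin \o (g \o V)).

Lemma integral_RintegralE (X : T -> R) : P.-integrable setT (EFin \o X) ->
  (\int[P]_w (X w)%:E)%E = (\int[P]_w X w)%:E.
Proof. by move=> iX; rewrite /Rintegral fineK //; exact: integrable_fin_num. Qed.

Lemma integrand_norm V g : integrand V g -> integrand V (fun y => `|g y|).
Proof.
move=> [mg ig]; split; first exact: measurableT_comp.
exact: integrable_norm.
Qed.

Lemma integrandD V g1 g2 :
  integrand V g1 -> integrand V g2 -> integrand V (fun y => g1 y + g2 y).
Proof.
move=> [mg1 ig1] [mg2 ig2]; split; first exact: measurable_funD.
have := integrableD measurableT ig1 ig2.
by apply: eq_integrable => // w _ /=; rewrite EFinD.
Qed.

Lemma integrand_indic V B : measurable B -> integrand V (\1_B).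
Proof.
move=> mB; split; first exact: measurable_indic.
exact: (integrable_indic P (measurable_preimage_RV V mB)).
Qed.

Lemma prod_split (F : nat -> R) N m : (m < N)%N ->
  \prod_(i < N) F i = F m * \prod_(i < N | i != m :> nat) F i.
Proof. by move=> mN; rewrite (bigD1 (Ordinal mN)). Qed.

Definition override f m g i := if i == m then g else f i.

Lemma prod_override (F : (R -> R) -> nat -> R) f m g N : (m < N)%N ->
  \prod_(i < N) F (override f m g i) i =
  F g m * \prod_(i < N | i != m :> nat) F (f i) i.
Proof.
move=> mN; rewrite (@prod_split (fun i => F (override f m g i) i) _ _ mN).
rewrite /override eqxx; congr (_ * _); apply: eq_bigr => i /negbTE ->; by [].
Qed.

(** The base case: for indicators the product formula is the independence
hypothesis, read on the finite index set [0, N). *)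
Lemma integral_prod_indic N (B : nat -> set R) : (forall i, measurable (B i)) ->
  (\int[P]_w (\prod_(i < N) \1_(B i) (Ys i w))%:E =
   (\prod_(i < N) \int[P]_w \1_(B i) (Ys i w))%:E)%E.
Proof.
move=> mB; pose J := seq_fset tt (iota 0 N).
have inJ i : (i \in J) = (i < N)%N by rewrite seq_fsetE mem_iota.
have bigJ (S : Type) (idx : S) (op : Monoid.com_law idx) (F : nat -> S) :
    \big[op/idx]_(i <- J) F i = \big[op/idx]_(i < N) F i.
  rewrite -(big_mkord xpredT) /index_iota subn0; apply: perm_big.
  by rewrite (perm_trans (seq_fset_perm _ _)) // undup_id // iota_uniq.
have mV i : measurable (Ys i @^-1` B i) by exact: measurable_preimage_RV.
set A := \bigcap_(i in [set` J]) (Ys i @^-1` B i).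
have mA : measurable A by apply: fin_bigcap_measurable.
transitivity (\int[P]_w (\1_A w)%:E)%E.
  apply: eq_integral => w _; congr EFin; rewrite indicE.
  have [/set_mem wA|wA] := boolP (w \in A).
    rewrite big1 // => i _; rewrite indicE mem_set //; apply: (wA i).
    by rewrite /= inJ.
  have [i iN wi] : exists2 i, (i < N)%N & ~ B i (Ys i w).
    apply: contrapT => h; move: wA; rewrite notin_setE; apply => i /=.
    by rewrite inJ => iN; apply: contrapT => wi; apply: h; exists i.
  rewrite (@prod_split (fun i => \1_(B i) (Ys i w)) _ _ iN) indicE memNset //.
  by rewrite mul0r.
rewrite integral_indic // setIT -[LHS]/(P A) /A indep // bigJ -prodEFin.
apply: eq_bigr => i _; rewrite -integral_RintegralE.
  by rewrite -(integral_indic_comp (Ys i) (mB i)); apply: eq_integral => w _; rewrite mul1r.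
by have [_] := integrand_indic (Ys i) (mB i).
Qed.

(** Induction on the number [m] of factors that may be arbitrary, the others
being indicators: [ge0_integral_factor] frees the factor [m], its hypothesis
being the induction hypothesis with an indicator put in that place. *)
Lemma ge0_integral_prod N f : (forall i, integrand (Ys i) (f i)) ->
  (forall i y, 0 <= f i y) ->
  (\int[P]_w (\prod_(i < N) f i (Ys i w))%:E =
   (\prod_(i < N) \int[P]_w f i (Ys i w))%:E)%E.
Proof.
suff H m : (m <= N)%N -> forall f, (forall i, integrand (Ys i) (f i)) ->
    (forall i y, 0 <= f i y) ->
    (forall i, (m <= i < N)%N -> exists2 B, measurable B & f i = \1_B) ->
  (\int[P]_w (\prod_(i < N) f i (Ys i w))%:E =
   (\prod_(i < N) \int[P]_w f i (Ys i w))%:E)%E.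
  move=> intf f0; apply: (H N) => // i /andP[Ni iN].
  by move: iN; rewrite ltnNge Ni.
move=> {f}; elim: m => [_|m IH mN] f intf f0 fB.
  have /choice[B BP] : forall i, exists B, measurable B /\ ((i < N)%N -> f i = \1_B).
    move=> i; have [iN|iN] := boolP (i < N)%N; last by exists setT.
    by have [B mB ->] := fB i iN; exists B.
  have mB i : measurable (B i) by case: (BP i).
  have fE (i : 'I_N) : f i = \1_(B i) by case: (BP i) => _; apply.
  transitivity (\int[P]_w (\prod_(i < N) \1_(B i) (Ys i w))%:E)%E.
    by apply: eq_integral => w _; congr EFin; apply: eq_bigr => i _; rewrite fE.
  by rewrite integral_prod_indic //; congr EFin; apply: eq_bigr => i _; rewrite fE.
have mf i : measurable_fun setT (f i) by case: (intf i).
have mfY i : measurable_fun setT (fun w => f i (Ys i w)).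
  by apply: measurableT_comp.
pose G w := \prod_(i < N | i != m :> nat) f i (Ys i w).
pose c := \prod_(i < N | i != m :> nat) \int[P]_w f i (Ys i w).
have mG : measurable_fun setT G.
  rewrite /G; under eq_fun do rewrite -big_filter.
  by apply: measurable_prod.
have G0 w : 0 <= G w by apply: prodr_ge0.
transitivity (\int[P]_w (G w * f m (Ys m w))%:E)%E.
  apply: eq_integral => w _; congr EFin.
  by rewrite (@prod_split (fun i => f i (Ys i w)) _ _ mN) mulrC.
rewrite (@ge0_integral_factor _ _ _ _ _ (Ys m) c) // => [|B mB].
  rewrite integral_RintegralE; last by case: (intf m).
  rewrite -EFinM; congr EFin.
  by rewrite (@prod_split (fun i => \int[P]_w f i (Ys i w)) _ _ mN) mulrC.
have intB i : integrand (Ys i) (override f m (\1_B) i).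
  by rewrite /override; case: eqP => // _; exact: integrand_indic.
have B0 i y : 0 <= override f m (\1_B) i y.
  by rewrite /override; case: eqP => // _; rewrite indicE.
have := IH (ltnW mN) _ intB B0.
have -> : (\int[P]_w (\prod_(i < N) override f m (\1_B) i (Ys i w))%:E =
     \int[P]_w (G w * \1_B (Ys m w))%:E)%E.
  apply: eq_integral => w _; congr EFin.
  by rewrite (prod_override (fun g i => g (Ys i w))) // mulrC.
rewrite (prod_override (fun g i => \int[P]_w g (Ys i w))) // => ->.
  rewrite mulrC EFinM; congr (_ * _)%E.
  rewrite -integral_RintegralE; last by case: (integrand_indic (Ys m) mB).
  by rewrite -(integral_indic_comp (Ys m) mB); apply: eq_integral => w _; rewrite mul1r.
move=> i /andP[mi iN]; rewrite /override; case: eqP => [_|/eqP im]; first by exists B.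
by apply: fB; rewrite iN andbT ltn_neqAle eq_sym im.
Qed.

Lemma integrable_prod N f : (forall i, integrand (Ys i) (f i)) ->
  P.-integrable setT (EFin \o (fun w => \prod_(i < N) f i (Ys i w))).
Proof.
move=> intf; apply/integrableP; split.
  apply/measurable_EFinP; apply: measurable_prod => i _.
  by apply: measurableT_comp => //; case: (intf i).
have := @ge0_integral_prod N (fun i y => `|f i y|).
move=> /(_ (fun i => integrand_norm (intf i))) /(_ (fun i y => normr_ge0 _)) h.
apply: le_lt_trans (ltry (\prod_(i < N) \int[P]_w `|f i (Ys i w)|)).
rewrite -h le_eqVlt; apply/orP; left; apply/eqP.
by apply: eq_integral => w _ /=; rewrite normr_prod.
Qed.

(** Same induction, now on the number of factors that may change sign, using
[f = (f + |f|) - |f|] with both terms nonnegative and integrable. *)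
Lemma Rintegral_prod N f : (forall i, integrand (Ys i) (f i)) ->
  \int[P]_w (\prod_(i < N) f i (Ys i w)) = \prod_(i < N) \int[P]_w f i (Ys i w).
Proof.
suff H m : (m <= N)%N -> forall f, (forall i, integrand (Ys i) (f i)) ->
    (forall i y, (m <= i < N)%N -> 0 <= f i y) ->
  \int[P]_w (\prod_(i < N) f i (Ys i w)) = \prod_(i < N) \int[P]_w f i (Ys i w).
  by move=> intf; apply: (H N) => // i y /andP[Ni]; rewrite ltnNge Ni.
move=> {f}; elim: m => [_|m IH mN] f intf f0.
  have fE (i : 'I_N) y : `|f i y| = f i y by rewrite ger0_norm // f0 /=.
  have := @ge0_integral_prod N (fun i y => `|f i y|).
  move=> /(_ (fun i => integrand_norm (intf i))) /(_ (fun i y => normr_ge0 _)) h.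
  apply: EFin_inj; rewrite -integral_RintegralE; last exact: integrable_prod.
  transitivity (\int[P]_w (\prod_(i < N) `|f i (Ys i w)|)%:E)%E.
    by apply: eq_integral => w _; congr EFin; apply: eq_bigr => i _; rewrite fE.
  rewrite h; congr EFin; apply: eq_bigr => i _.
  by apply: eq_Rintegral => w _; rewrite fE.
pose g1 y := f m y + `|f m y|; pose g2 y := `|f m y|.
have int2 : integrand (Ys m) g2 by exact: integrand_norm.
have int1 : integrand (Ys m) g1 by exact: integrandD.
have g10 y : 0 <= g1 y by rewrite /g1; have := ler_norm (- f m y); rewrite normrN; lra.
have g20 y : 0 <= g2 y by exact: normr_ge0.
have fmE y : f m y = g1 y - g2 y by rewrite /g1 /g2 addrK.
have into g : integrand (Ys m) g -> forall i, integrand (Ys i) (override f m g i).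
  by move=> ig i; rewrite /override; case: eqP => // ->.
have o0 g : (forall y, 0 <= g y) ->
    forall i y, (m <= i < N)%N -> 0 <= override f m g i y.
  move=> g0 i y /andP[mi iN]; rewrite /override; case: eqP => // /eqP im.
  by apply: f0; rewrite iN andbT ltn_neqAle eq_sym im.
have E1 := IH (ltnW mN) _ (into _ int1) (o0 _ g10).
have E2 := IH (ltnW mN) _ (into _ int2) (o0 _ g20).
transitivity (\int[P]_w (\prod_(i < N) override f m g1 i (Ys i w) -
                         \prod_(i < N) override f m g2 i (Ys i w))).
  apply: eq_Rintegral => w _.
  rewrite !(prod_override (fun g i => g (Ys i w))) // -mulrBl -fmE.
  exact: (@prod_split (fun i => f i (Ys i w))).
rewrite RintegralB //; [|exact: integrable_prod (into _ int1)|exact: integrable_prod (into _ int2)].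
rewrite E1 E2 !(prod_override (fun g i => \int[P]_w g (Ys i w))) // -mulrBl.
rewrite (@prod_split (fun i => \int[P]_w f i (Ys i w)) _ _ mN); congr (_ * _).
rewrite -RintegralB //; [|by case: int1|by case: int2].
by apply: eq_Rintegral => w _; rewrite -fmE.
Qed.

End IndependentProducts.

(** * Moments of partial sums *)

Section DegenerateMoments.
Context {d : measure_display} {T : measurableType d} {R : realType}.
Variable P : probability T R.

Definition dmoment lambda (Y : T -> R) k := \int[P]_w dbinom lambda (Y w) k.

Fixpoint conv_pow (a : nat -> R) j : nat -> R :=
  if j is i.+1 then cauchyp (conv_pow a i) a else fun n => (n == 0%N)%:R.

Lemma measurable_dbinom lambda k : measurable_fun setT (fun y : R => dbinom lambda y k).
Proof.
apply: measurable_funM => //; rewrite /dfact.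
by apply: measurable_prod => i _; apply: measurable_funB.
Qed.

Lemma Rintegral_sum (F : nat -> T -> R) n :
  (forall k, P.-integrable setT (EFin \o F k)) ->
  \int[P]_w (\sum_(k < n) F k w) = \sum_(k < n) \int[P]_w F k w.
Proof.
move=> iF; have iS m : P.-integrable setT (EFin \o (fun w => \sum_(k < m) F k w)).
  have := @integrable_sum _ _ _ P _ measurableT 'I_m (index_enum 'I_m) xpredT _ (fun k _ => iF k).
  by apply: eq_integrable => // w _ /=; rewrite sumEFin.
elim: n => [|n IH].
  have := Rintegral_cst P measurableT (0 : R); rewrite mul0r big_ord0.
  by apply: etrans; apply: eq_Rintegral => w _; rewrite big_ord0.
rewrite big_ord_recr /= -IH -RintegralD //.
by apply: eq_Rintegral => w _; rewrite big_ord_recr.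
Qed.

Section PartialSums.
Variables (Ys : nat -> {RV P >-> R}) (lambda : R) (a : nat -> R).
Hypothesis indep : mutually_independent Ys.
Hypothesis intY : forall i k, integrand (Ys i) (fun y => dbinom lambda y k).
Hypothesis momY : forall i k, dmoment lambda (Ys i) k = a k.

Let prod_ge_split (F : nat -> R) N j : (j < N)%N ->
  \prod_(i < N | (j <= i)%N) F i = F j * \prod_(i < N | (j < i)%N) F i.
Proof.
move=> jN; rewrite (bigD1 (Ordinal jN)) //=; congr (_ * _).
by apply: eq_bigl => i; rewrite ltn_neqAle andbC eq_sym.
Qed.

Let override_split (F : (R -> R) -> nat -> R) f g N j : (j < N)%N ->
  \prod_(i < N | (j <= i)%N) F (override f j g i) i =
  F g j * \prod_(i < N | (j < i)%N) F (f i) i.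
Proof.
move=> jN; rewrite (@prod_ge_split (fun i => F (override f j g i) i)) //.
rewrite /override eqxx; congr (_ * _); apply: eq_bigr => i.
by rewrite ltn_neqAle => /andP[ji _]; rewrite eq_sym (negbTE ji).
Qed.

(** The remaining factors [f i (Ys i)], [i >= j], are carried along so that the
induction on [j] can absorb [Ys j] as one of them: after [dbinomD] each term
is the induction hypothesis with [f j] replaced by [dbinom lambda ^~ (n - k)].
Independence is thus used once, in the base case. *)
Lemma dbinom_partial_sum_prod N j n (f : nat -> R -> R) : (j <= N)%N ->
  (forall i, integrand (Ys i) (f i)) ->
  let X w := dbinom lambda (partial_sum Ys j w) n *
             \prod_(i < N | (j <= i)%N) f i (Ys i w) in
  P.-integrable setT (EFin \o X) /\
  \int[P]_w X w = conv_pow a j n *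
                  \prod_(i < N | (j <= i)%N) \int[P]_w f i (Ys i w).
Proof.
elim: j n f => [|j IH] n f jN intf /=.
  have XE w : dbinom lambda (partial_sum Ys 0 w) n *
      \prod_(i < N | (0 <= i)%N) f i (Ys i w) =
      (n == 0%N)%:R * \prod_(i < N) f i (Ys i w).
    by rewrite /partial_sum big_ord0 dbinom_at0.
  have iP := integrable_prod indep N intf; split.
    have := integrableZl measurableT (n == 0%N)%:R iP.
    by apply: eq_integrable => // w _ /=; rewrite XE EFinM.
  under eq_Rintegral do rewrite XE.
  by rewrite RintegralZl //; congr (_ * _); exact: (Rintegral_prod indep _ intf).
pose g k := override f j (fun y => dbinom lambda y k).
have intg k i : integrand (Ys i) (g k i).
  by rewrite /g /override; case: eqP => // ->.
pose X k w := dbinom lambda (partial_sum Ys j w) k *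
  \prod_(i < N | (j <= i)%N) g (n - k)%N i (Ys i w).
have XE w : dbinom lambda (partial_sum Ys j.+1 w) n *
    \prod_(i < N | (j < i)%N) f i (Ys i w) = \sum_(k < n.+1) X k w.
  rewrite /partial_sum big_ord_recr /= dbinomD /cauchyp mulr_suml.
  apply: eq_bigr => k _.
  by rewrite /X /g (override_split (fun h i => h (Ys i w))) // mulrA.
have iX k : P.-integrable setT (EFin \o X k) by have [] := IH k _ (ltnW jN) (intg (n - k)%N).
split.
  have := @integrable_sum _ _ _ P _ measurableT 'I_n.+1 (index_enum 'I_n.+1) xpredT _ (fun k _ => iX k).
  by apply: eq_integrable => // w _ /=; rewrite sumEFin XE.
under eq_Rintegral do rewrite XE.
rewrite Rintegral_sum // /cauchyp mulr_suml; apply: eq_bigr => k _.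
have [_ ->] := IH k _ (ltnW jN) (intg (n - k)%N).
rewrite /g (override_split (fun h i => \int[P]_w h (Ys i w))) //.
by rewrite -(momY j) mulrA.
Qed.

Lemma dmoment_partial_sum j n :
  P.-integrable setT (EFin \o (fun w => dbinom lambda (partial_sum Ys j w) n)) /\
  dmoment lambda (partial_sum Ys j) n = conv_pow a j n.
Proof.
have := @dbinom_partial_sum_prod j j n (fun i y => dbinom lambda y 0) (leqnn j).
move=> /(_ (fun i => intY i 0)) /=.
have noi (F : 'I_j -> R) : \prod_(i < j | (j <= i)%N) F i = 1.
  by rewrite big_pred0 // => i; rewrite leqNgt ltn_ord.
rewrite noi mulr1 => -[iX EX]; split.
  by apply: eq_integrable iX => // w _ /=; rewrite noi mulr1.
by rewrite -EX; apply: eq_Rintegral => w _; rewrite noi mulr1.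
Qed.

Lemma pdstirling2E n k : pdstirling2 Ys lambda n k =
  n`!%:R / k`!%:R * \sum_(j < k.+1) 'C(k, j)%:R * (-1) ^+ (k - j) * conv_pow a j n.
Proof.
rewrite /pdstirling2 (mulrC n`!%:R) -mulrA; congr (_ * _).
rewrite mulr_sumr; apply: eq_bigr => j _; rewrite mulrCA; congr (_ * _).
have [iX <-] := dmoment_partial_sum j n.
rewrite unlock -RintegralZl //; congr fine; apply: eq_integral => w _; congr EFin.
by rewrite /dbinom mulrC divfK // pnatr_eq0 -lt0n fact_gt0.
Qed.
End PartialSums.
End DegenerateMoments.

(** * The generating function of the moments *)

Section MomentGeneratingFunction.
Context {d : measure_display} {T : measurableType d} {R : realType}.
Variables (P : probability T R) (Y : {RV P >-> R}).

(** Both integrals are integrals of [g] against the common distribution. *)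
Lemma integrand_identically_distributed (Z : {RV P >-> R}) g :
  identically_distributed Z Y -> integrand Y g ->
  integrand Z g /\ \int[P]_w g (Z w) = \int[P]_w g (Y w).
Proof.
move=> ZY [mg ig].
have mg' : measurable_fun setT (EFin \o g) by apply/measurable_EFinP.
have eqi (h : R -> \bar R) :
    (\int[distribution P Z]_y h y = \int[distribution P Y]_y h y)%E.
  by apply: eq_measure_integral => A mA _; exact: ZY.
have iZ : integrand Z g.
  split=> //; apply/integrableP; split.
    by apply/measurable_EFinP; exact: measurableT_comp.
  move/integrableP : ig => [_]; apply: le_lt_trans.
  have mag : measurable_fun setT (fun y => `|(g y)%:E|%E) by exact: measurableT_comp.
  have := ge0_integral_distribution Z mag (fun y => abse_ge0 _).
  have := ge0_integral_distribution Y mag (fun y => abse_ge0 _).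
  by rewrite eqi => -> <-.
split=> //; congr fine.
rewrite -[LHS](@integral_distribution _ _ _ _ _ _ Z (EFin \o g)) //; last by case: iZ.
by rewrite eqi integral_distribution.
Qed.

Section ExponentialMoment.
Variable delta : R.
Hypothesis delta0 : 0 < delta.
Hypothesis iexp : P.-integrable setT (EFin \o (fun w => expR (delta * `|Y w|))).

Lemma integrand_dbinom lambda k : integrand Y (fun y => dbinom lambda y k).
Proof.
split; first exact: measurable_dbinom.
pose C := (expR (delta * `|lambda|) / delta) ^+ k.
have iC : P.-integrable setT (fun w => (C%:E * (expR (delta * `|Y w|))%:E)%E).
  exact: integrableZl.
apply: le_integrable iC => //.
  apply/measurable_EFinP; apply: measurableT_comp => //; exact: measurable_dbinom.
move=> w _ /=; rewrite lee_fin [leRHS]ger0_norm.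
  by rewrite mulrC; exact: dbinom_bound.
by rewrite mulr_ge0 ?expR_ge0 // exprn_ge0 // divr_ge0 ?expR_ge0 // ltW.
Qed.

Lemma pseries_dmoment lambda t N : pseries (dmoment P lambda Y) t N =
  \int[P]_w pseries (dbinom lambda (Y w)) t N.
Proof.
have iF k : P.-integrable setT (EFin \o (fun w => dbinom lambda (Y w) k * t ^+ k)).
  have [_ ik] := integrand_dbinom lambda k.
  have := integrableZr measurableT (t ^+ k) ik.
  by apply: eq_integrable => // w _ /=; rewrite EFinM.
have ik k : P.-integrable setT (EFin \o (fun w => dbinom lambda (Y w) k)).
  by have [_ +] := integrand_dbinom lambda k.
rewrite /pseries /series /= big_mkord.
under eq_bigr => k _ do rewrite /dmoment -RintegralZr //.
rewrite -(Rintegral_sum N iF).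
by apply: eq_Rintegral => w _; rewrite big_mkord.
Qed.

(** Dominated convergence for the partial sums, with dominating function
[2 * expR (delta * |Y|)]. *)
Lemma has_pseries_dmoment lambda :
  has_pseries (dmoment P lambda Y) (fun t => fine 'E_P[fun w => dexp lambda (Y w) t]).
Proof.
pose q := expR (delta * `|lambda|) / delta.
have q0 : 0 <= q by rewrite divr_ge0 ?expR_ge0 // ltW.
have q1 : 1 <= 1 + q by lra.
near=> t.
have qt : q * `|t| <= 1 / 2.
  have : (1 + q) * `|t| <= 1 / 2 by near: t; exact: small_ball.
  by have := normr_ge0 t; lra.
pose E w := expR (delta * `|Y w|).
have psb w N : `|pseries (dbinom lambda (Y w)) t N| <= 2 * E w.
  have := @pseries_block_bound _ (dbinom lambda (Y w)) (E w) q t 0 N.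
  rewrite addn0 pseries0 subr0 expr0 mulr1; apply => //; first exact: expR_ge0.
  by move=> n; exact: dbinom_bound.
have psc w : pseries (dbinom lambda (Y w)) t @ \oo --> dexp lambda (Y w) t.
  exact: cvg_pseries_dexp delta0 qt.
have mps N : measurable_fun setT (fun w => pseries (dbinom lambda (Y w)) t N).
  rewrite /pseries /series /=; apply: measurable_sum => k.
  apply: measurable_funM => //.
  by apply: measurableT_comp (measurable_dbinom lambda k) _.
have mde : measurable_fun setT (fun w => dexp lambda (Y w) t).
  by apply: measurable_fun_cvg mps _ => w _; exact: psc.
have i2E : P.-integrable setT (fun w => (2%:E * (E w)%:E)%E) by exact: integrableZl.
have [] := @dominated_convergence _ _ _ P _ measurableT
  (fun N w => (pseries (dbinom lambda (Y w)) t N)%:E)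
  (fun w => (dexp lambda (Y w) t)%:E) (fun w => (2%:E * (E w)%:E)%E).
- by move=> N; apply/measurable_EFinP.
- by apply/measurable_EFinP.
- by apply: aeW => w _; apply: cvg_EFin; [exact: nearW | exact: psc].
- exact: i2E.
- by apply: aeW => w N _ /=; rewrite lee_fin psb.
move=> ide _ cv; rewrite unlock.
have -> : pseries (dmoment P lambda Y) t =
    fine \o (fun N => \int[P]_w (pseries (dbinom lambda (Y w)) t N)%:E)%E.
  by apply/funext => N; rewrite pseries_dmoment.
apply: fine_cvg; rewrite fineK; first exact: cv.
exact: integrable_fin_num.
Unshelve. all: by end_near. Qed.

End ExponentialMoment.

(** [expR (delta |Y|) <= expR (delta Y) + expR (- delta Y)]. *)
Lemma mgf_exists_integrable : mgf_exists Y -> exists2 delta : R, 0 < delta &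
  P.-integrable setT (EFin \o (fun w => expR (delta * `|Y w|))).
Proof.
move=> [r r0 Mr]; exists (r / 2); first by rewrite divr_gt0.
set s := r / 2; have s0 : 0 < s by rewrite divr_gt0.
have mE (c : R) : measurable_fun setT (fun w => expR (Y w * c)).
  by apply: measurableT_comp => //; exact: measurable_funM.
have iE (c : R) : `|c| < r -> P.-integrable setT (EFin \o (fun w => expR (Y w * c))).
  move=> cr; apply/integrableP; split; first by apply/measurable_EFinP.
  have := Mr c cr; rewrite /mmt_gen_fun unlock; apply: le_lt_trans.
  rewrite le_eqVlt; apply/orP; left; apply/eqP; apply: eq_integral => w _ /=.
  by rewrite ger0_norm // expR_ge0.
have sr : `|s| < r by rewrite gtr0_norm // /s; lra.
have sr' : `|- s| < r by rewrite normrN.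
have := integrableD measurableT (iE _ sr) (iE _ sr').
apply: le_integrable => //.
  apply/measurable_EFinP; apply: measurableT_comp => //.
  by apply: measurable_funM => //; exact: measurableT_comp.
move=> w _ /=; rewrite lee_fin [leRHS]ger0_norm ?addr_ge0 ?expR_ge0 //.
rewrite [leLHS]ger0_norm ?expR_ge0 // mulrN (mulrC (Y w)).
have [Y0|Y0] := lerP 0 (Y w).
  by rewrite ger0_norm // lerDl expR_ge0.
by rewrite ltr0_norm // mulrN lerDr expR_ge0.
Qed.

End MomentGeneratingFunction.

(** * Truncated series *)

Section TruncatedSeries.
Context {R : realType}.
Implicit Types (p q D E F : {poly R}) (u v : nat -> R).

Lemma has_pseries_poly q : has_pseries (fun n => q`_n) (fun t => q.[t]).
Proof.
near=> t; apply: cvg_near_cst; exists (size q) => // N /= qN.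
by rewrite /pseries /series /= big_mkord (horner_coef_wide t qN).
Unshelve. all: by end_near. Qed.

Lemma eq_coef_upto p q n : (forall i, (i <= n)%N -> p`_i = q`_i) ->
  exists r : {poly R}, p = q + r * 'X^(n.+1).
Proof.
move=> pq; exists (drop_poly n.+1 p - drop_poly n.+1 q).
have tpq : take_poly n.+1 p = take_poly n.+1 q.
  by apply/polyP => i; rewrite !coef_take_poly; case: ltnP => // /pq.
rewrite mulrBl -{1}[p](poly_take_drop n.+1) -{1}[q](poly_take_drop n.+1) tpq.
ring.
Qed.

Lemma factor_X p : p`_0 = 0 -> p = drop_poly 1 p * 'X.
Proof.
move=> p0; rewrite -[LHS](poly_take_drop 1) expr1.
suff -> : take_poly 1 p = 0 by rewrite add0r.
by apply/polyP => i; rewrite coef_take_poly coef0; case: i => [|i].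
Qed.

(** [D = E / (1 - 'X)] and [F = 1 / (1 - p)] modulo ['X^(n+1)] give
[D \Po p = F * (E \Po p)] modulo ['X^(n+1)]: since ['X] divides [p], substituting
[p] maps the ideal of ['X^(n+1)] into itself. *)
Lemma coef_comp_quotient n p D E F : p`_0 = 0 ->
  (forall i, (i <= n)%N -> ((1 - 'X) * D)`_i = E`_i) ->
  (forall i, (i <= n)%N -> ((1 - p) * F)`_i = (i == 0%N)%:R) ->
  (D \Po p)`_n = (F * (E \Po p))`_n.
Proof.
move=> p0 /eq_coef_upto[r rE] Fp.
have [|s sE] := @eq_coef_upto ((1 - p) * F) 1 n.
  by move=> i /Fp ->; rewrite coef1.
have pE := factor_X p0; set p' := drop_poly 1 p in pE.
have := congr1 (comp_poly p) rE.
have c1 : 1 \Po p = 1 by rewrite -polyC1 comp_polyC.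
rewrite comp_polyM comp_polyD comp_polyM comp_polyB comp_polyX c1 comp_Xn_poly.
have -> : p ^+ n.+1 = p' ^+ n.+1 * 'X^(n.+1) by rewrite {1}pE exprMn.
move=> h.
have : D \Po p = F * (E \Po p) + (F * (r \Po p) * p' ^+ n.+1 - s * (D \Po p)) * 'X^(n.+1).
  transitivity ((1 - p) * F * (D \Po p) - s * (D \Po p) * 'X^(n.+1)).
    by rewrite sE; ring.
  have -> : (1 - p) * F * (D \Po p) = F * ((1 - p) * (D \Po p)) by ring.
  by rewrite h; ring.
by move=> ->; rewrite coefD coefMXn ltnSn addr0.
Qed.

Lemma coef_comp_poly_trunc n u p j :
  ((\poly_(i < n) u i) \Po p)`_j = \sum_(i < n) u i * (p ^+ i)`_j.
Proof.
rewrite poly_def raddf_sum coef_sum; apply: eq_bigr => i _ /=.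
by rewrite comp_polyZ comp_Xn_poly coefZ.
Qed.

Lemma coef_exp_small p m j : p`_0 = 0 -> (j < m)%N -> (p ^+ m)`_j = 0.
Proof.
move=> p0 jm.
by rewrite (factor_X p0) exprMn coefMXn jm.
Qed.

Lemma conv_pow_coef (a : nat -> R) n j i : (i <= n)%N ->
  conv_pow a j i = ((\poly_(k < n.+1) a k) ^+ j)`_i.
Proof.
elim: j i => [|j IH] i iN /=; first by rewrite expr0 coef1.
rewrite exprSr coefM /cauchyp; apply: eq_bigr => k _.
have kN : (k <= n)%N by rewrite (leq_trans _ iN) // -ltnS.
by rewrite IH // coef_poly ltnS (leq_trans (leq_subr _ _) iN).
Qed.

(** The binomial theorem for [(phi - 1) ^+ k], with [phi] truncated at degree [n]. *)
Lemma sum_binom_conv_pow (a : nat -> R) n k i : (i <= n)%N ->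
  \sum_(j < k.+1) 'C(k, j)%:R * (-1) ^+ (k - j) * conv_pow a j i =
  ((\poly_(l < n.+1) a l - 1) ^+ k)`_i.
Proof.
move=> iN; rewrite [_ - 1]addrC exprDn coef_sum; apply: eq_bigr => j _.
rewrite coefMn -[RHS]mulr_natl -mulrA (conv_pow_coef _ _ iN); congr (_ * _).
by rewrite -polyCN -polyC_exp coefCM.
Qed.

End TruncatedSeries.

(** * The coefficient sequences and the identity *)

Lemma dmoment0 (R : realType) (d : measure_display) (T : measurableType d)
    (P : probability T R) (lambda : R) (Y : T -> R) : dmoment P lambda Y 0 = 1.
Proof.
transitivity (\int[P]_w (1 : R)).
  by apply: eq_Rintegral => w _; rewrite dbinom0.
apply: etrans (Rintegral_cst P measurableT (1 : R)) _.
by rewrite mul1r -[X in fine X]/(P setT) probability_setT.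
Qed.

Lemma dderangement_coef (R : realType) (lambda x : R) :
  exists D : nat -> R, (forall l, dderangement lambda l x = l`!%:R * D l) /\
    cauchyp (fun n => (1 - 'X : {poly R})`_n) D = dbinom lambda (x - 1).
Proof.
pose u n := (1 - 'X : {poly R})`_n.
have u0 : u 0%N = 1 by rewrite /u coefB coef1 coefX subr0.
exists (quot_coef u (dbinom lambda (x - 1))); split; last exact: cauchyp_quot.
apply: egf_coefE.
have -> : (fun t => dexp lambda (x - 1) t / (1 - t)) =
    (fun t => dexp lambda (x - 1) t / (1 - 'X).[t]).
  by apply/funext => t; rewrite hornerD hornerN hornerX hornerC.
exact: has_pseries_div (has_pseries_poly _) u0 (has_pseries_dexp _ _).
Qed.

Lemma pdfubini_coef (R : realType) (d : measure_display) (T : measurableType d)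
    (P : probability T R) (lambda : R) (Y : {RV P >-> R}) (delta : R) :
  0 < delta -> P.-integrable setT (EFin \o (fun w => expR (delta * `|Y w|))) ->
  exists F : nat -> R, (forall n, pdfubini Y lambda n 1 = n`!%:R * F n) /\
    cauchyp (fun n => (2%:P)`_n - dmoment P lambda Y n) F =
    (fun n => (1 : {poly R})`_n).
Proof.
move=> d0 iexp; pose v n := (2%:P)`_n - dmoment P lambda Y n.
have v0 : v 0%N = 1 by rewrite /v coefC dmoment0; ring.
exists (quot_coef v (fun n => (1 : {poly R})`_n)); split; last exact: cauchyp_quot.
apply: egf_coefE.
have vf := has_pseriesB (has_pseries_poly 2%:P) (has_pseries_dmoment d0 iexp lambda).
have := has_pseries_div vf v0 (has_pseries_poly 1).
set f := (X in has_pseries _ X) => vf1; set g := (X in has_pseries _ X).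
suff -> : g = f by exact: vf1.
by apply/funext => t; rewrite /f /g !hornerC; congr (_ / _); ring.
Qed.

Theorem theorem2p4 (R : realType) (d : measure_display) (T : measurableType d)
    (P : probability T R) (lambda : R)
    (Y : {RV P >-> R}) (Ys : nat -> {RV P >-> R}) :
  lambda != 0 ->
  mgf_exists Y ->
  iid_copies Y Ys ->
  forall (x : R) (n : nat),
    \sum_(l < n.+1) dderangement lambda l x * pdstirling2 Ys lambda n l =
    \sum_(j < n.+1) \sum_(m < j.+1)
      'C(n, j)%:R * pdstirling2 Ys lambda j m *
      pdfubini Y lambda (n - j) 1 * dfact lambda (x - 1) m.
Proof.
move=> _ /mgf_exists_integrable[delta delta0 iexp] [indep same] x n.
pose a := dmoment P lambda Y.
have intY k := integrand_dbinom delta0 iexp lambda k.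
have intYs i k : integrand (Ys i) (fun y => dbinom lambda y k).
  by have [] := integrand_identically_distributed (same i) (intY k).
have momY i k : dmoment P lambda (Ys i) k = a k.
  by have [_] := integrand_identically_distributed (same i) (intY k).
pose p := \poly_(k < n.+1) a k - 1.
have p0 : p`_0 = 0 by rewrite coefB coef_poly coef1 /a dmoment0 subrr.
have fact_neq0 k : k`!%:R != 0 :> R by rewrite pnatr_eq0 -lt0n fact_gt0.
have stirling j m : (j <= n)%N ->
    pdstirling2 Ys lambda j m = j`!%:R / m`!%:R * (p ^+ m)`_j.
  by move=> jn; rewrite (pdstirling2E indep intYs momY) (sum_binom_conv_pow _ _ jn).
have [D [DE Dquot]] := dderangement_coef lambda x.
have [F [FE Fquot]] := pdfubini_coef lambda delta0 iexp.
pose tr (u : nat -> R) := \poly_(i < n.+1) u i.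
have coef_tr u i : (i <= n)%N -> (tr u)`_i = u i by move=> ?; rewrite coef_poly ltnS ifT.
have trM (q : {poly R}) u v i : (i <= n)%N ->
    (forall k, (k <= n)%N -> q`_k = v k) -> (q * tr u)`_i = cauchyp v u i.
  move=> iN qv; rewrite coefM; apply: eq_bigr => k _.
  by rewrite qv ?coef_tr // ?(leq_trans _ iN) ?leq_subr // -ltnS.
have key : (tr D \Po p)`_n = (tr F * (tr (dbinom lambda (x - 1)) \Po p))`_n.
  apply: coef_comp_quotient => // i iN.
    by rewrite (trM _ _ _ _ iN (fun k _ => erefl)) Dquot coef_tr.
  have -> : 1 - p = 2%:P - tr a by rewrite /p -/(tr a) polyCD; ring.
  rewrite (trM _ _ (fun k => (2%:P)`_k - a k) _ iN) ?Fquot ?coef1 // => k kn.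
  by rewrite coefB coef_tr.
have -> : \sum_(l < n.+1) dderangement lambda l x * pdstirling2 Ys lambda n l =
    n`!%:R * (tr D \Po p)`_n.
  rewrite coef_comp_poly_trunc mulr_sumr; apply: eq_bigr => l _.
  by rewrite DE stirling //; field.
rewrite key coefMr mulr_sumr; apply: eq_bigr => j _.
have jn : (j <= n)%N by rewrite -ltnS.
rewrite coef_comp_poly_trunc coef_tr ?leq_subr // !mulr_sumr.
(* The terms with [j < m] vanish, as ['X^m] divides [p ^+ m]. *)
rewrite (bigID (fun m : 'I_n.+1 => m < j.+1)%N) /= [X in _ + X]big1 ?addr0; last first.
  by move=> m; rewrite -leqNgt => jm; rewrite coef_exp_small // !mulr0.
pose G m := n`!%:R * (F (n - j)%N * (dbinom lambda (x - 1) m * (p ^+ m)`_j)).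
rewrite -(@big_ord_widen _ _ _ j.+1 n.+1 G) //; apply: eq_bigr => m _.
rewrite stirling // FE /G /dbinom -(bin_fact jn) !natrM.
by field.
Qed.
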